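(* For all integers $n\geq 1$ and $0\leq r\leq n$, $\frac{1}{n}\binom{n}{r}\leq \dim \mathcal{D}(U(r,n))$.
   Context: $U(r,n)$ is the uniform matroid of rank $r$ on $E=\{1,\ldots,n\}$ (all $r$-subsets are bases). A valuation of $U(r,n)$ is a function $\nu:\binom{E}{r}\to\mathbb{R}$ such that for all $B,B'\in\binom{E}{r}$ and $e\in B\setminus B'$ there is $f\in B'\setminus B$ with $\nu(B)+\nu(B')\geq\nu(B-e+f)+\nu(B'+e-f)$. Let $Z(r,E)$ be the set of triples $(S,ab,cd)$ with $S\in\binom{E}{r-2}$ and $a,b,c,d\in E\setminus S$ distinct; $Sab:=S\cup\{a,b\}$ etc. For a valuation $\nu$, $[\nu]:=\{(S,ab,cd)\in Z(r,E):\nu(Sac)+\nu(Sbd)=\nu(Sad)+\nu(Sbc)\}$; valuations are combinatorially equivalent if their sets $[\cdot]$ coincide. The cells of the fan $\mathcal{D}(U(r,n))$ are the topological closures of the combinatorial equivalence classes in $\mathbb{R}^{\binom{E}{r}}$, and $\dim\mathcal{D}(U(r,n))$ is the maximum dimension of a cell. *)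

(* Defs.v *)
From mathcomp Require Import all_boot all_order all_algebra.
From mathcomp Require Import all_classical all_reals all_analysis.

Set Implicit Arguments.
Unset Strict Implicit.
Unset Printing Implicit Defensive.

Import Order.TTheory GRing.Theory Num.Theory.
Import numFieldNormedType.Exports.

Local Open Scope ring_scope.

(* The ground set {1, ..., n} is represented by 'I_n = {0, ..., n-1}. *)
Definition rsubset (n r : nat) : finType := {B : {set 'I_n} | #|B| == r}.

(* The coordinate space of all real functions on the r-subsets, with the
   library's topology and vector space structure on row vectors. *)
Definition rspace (R : realType) (n r : nat) := 'rV[R]_#|rsubset n r|.

(* nu(A); the value 0 for #|A| != r is a dummy that is never used below. *)
Definition value (R : realType) (n r : nat) (nu : rspace R n r)
    (A : {set 'I_n}) : R :=
  if insub A is Some B then nu ord0 (enum_rank (B : rsubset n r)) else 0.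

Definition valuation (R : realType) (n r : nat) (nu : rspace R n r) : Prop :=
  forall B B' : {set 'I_n}, #|B| = r -> #|B'| = r ->
  forall e, e \in B :\: B' ->
  exists2 f, f \in B' :\: B &
    value nu (f |: (B :\ e)) + value nu (e |: (B' :\ f))
      <= value nu B + value nu B'.

Definition triple (n : nat) : finType :=
  ({set 'I_n} * ('I_n * 'I_n) * ('I_n * 'I_n))%type.

(* Z(r, E), with S written T.  The condition #|T| + 2 = r makes Z(r, E) empty for
   r < 2.  Pairs ab and cd are kept as ordered pairs; the equation in comb_type
   is invariant under exchanging a and b, or c and d, so this is immaterial. *)
Definition Ztriples (n r : nat) : {set triple n} :=
  [set z : triple n | let: (T, (a, b), (c, d)) := z in
    [&& (#|T| + 2 == r)%N, uniq [:: a; b; c; d] &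
        all (fun x => x \notin T) [:: a; b; c; d]]]%SET.

Definition comb_type (R : realType) (n r : nat) (nu : rspace R n r) :
    {set triple n} :=
  [set z : triple n in Ztriples n r | let: (T, (a, b), (c, d)) := z in
    value nu (T :|: [set a; c]) + value nu (T :|: [set b; d])
      == value nu (T :|: [set a; d]) + value nu (T :|: [set b; c])]%SET.

(* The combinatorial equivalence class of the valuations nu with [nu] = C. *)
Definition comb_class (R : realType) (n r : nat) (C : {set triple n}) :
    set (rspace R n r) :=
  [set nu | valuation nu /\ comb_type nu = C]%classic.
Arguments comb_class R {n} r C.

(* The largest d such that A contains d + 1 affinely independent points x0 and
   the d rows of X, i.e. the dimension of the affine hull of A (nonempty). *)
Definition affine_dim (R : realType) (m : nat) (A : set 'rV[R]_m) : nat :=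
  (\max_(d < m.+1 | `[< exists (x0 : 'rV[R]_m) (X : 'M[R]_(d, m)),
      [/\ A x0, forall i, A (row i X)
        & row_free (\matrix_(i < d) (row i X - x0))] >]) d)%N.

(* dim D(U(r,n)): the maximum runs over the finitely many nonempty classes,
   each indexed by its common value C of [.]. *)
Definition dim_dressian (R : realType) (n r : nat) : nat :=
  (\max_(C : {set triple n} | `[< (comb_class R r C !=set0)%classic >])
     affine_dim (closure (comb_class R r C)))%N.

(* Main.v *)
(* The map B |-> sum of the elements of B, with values in Z/n, separates any two
   r-subsets that differ in exactly one element.  By pigeonhole one of its n
   fibres contains at least binom(n,r)/n of the r-subsets.  Fix such a fibre F.
   Every function that is positive on F and zero off F is a valuation, and all
   these functions have the same combinatorial type; so a single equivalence
   class contains an open orthant of dimension #|F|. *)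
Require Import Defs.
From mathcomp Require Import all_boot all_order all_algebra.
From mathcomp Require Import all_classical all_reals all_analysis.
From mathcomp Require Import finset.
Import Order.TTheory GRing.Theory Num.Theory.
Import numFieldNormedType.Exports.
Local Open Scope ring_scope.

(** Addition on ['I_n.+1] is modulo [n.+1], the size of the ground set, so the sum lives in a cyclic
    group with as many elements as the ground set. *)
Definition set_sum {n : nat} (A : {set 'I_n.+1}) : 'I_n.+1 := \sum_(i in A) i.

Lemma set_sum_exchange (n : nat) (B : {set 'I_n.+1}) (e f : 'I_n.+1) :
  e \in B -> f \notin B -> set_sum (f |: B :\ e)%SET = set_sum B - e + f.
Proof.
move=> eB fB; rewrite /set_sum big_setU1 /=; last by rewrite !inE negb_and fB orbT.
by rewrite [in RHS](big_setD1 e) //= [e + _]addrC addrK addrC.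
Qed.

Lemma set_sumU2 (n : nat) (T : {set 'I_n.+1}) (a c : 'I_n.+1) :
  a \notin T -> c \notin T -> a != c ->
  set_sum (T :|: [set a; c])%SET = set_sum T + a + c.
Proof.
move=> aT cT ac; rewrite /set_sum setUC -setUA big_setU1 /=; last first.
  by rewrite !inE negb_or ac.
by rewrite big_setU1 //= addrA addrC addrA.
Qed.

Lemma cardsU2 (n : nat) (T : {set 'I_n}) (a c : 'I_n) :
  a \notin T -> c \notin T -> a != c -> #|(T :|: [set a; c])%SET| = (#|T| + 2)%N.
Proof.
move=> aT cT ac; rewrite setUC -setUA cardsU1 !inE negb_or ac aT cardsU1 cT.
by rewrite !add1n addn2.
Qed.

Lemma card_exchange (n : nat) (B : {set 'I_n}) (e f : 'I_n) :
  e \in B -> f \notin B -> #|(f |: B :\ e)%SET| = #|B|.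
Proof. by move=> eB fB; rewrite cardsU1 !inE (negPf fB) andbF /= (cardsD1 e B) eB. Qed.

Definition vec_of_fun (R : realType) (n r : nat) (g : {set 'I_n} -> R) :
    rspace R n r :=
  \row_j g (val (enum_val j)).

Lemma value_vec_of_fun (R : realType) (n r : nat) (g : {set 'I_n} -> R)
    (A : {set 'I_n}) :
  #|A| = r -> value (vec_of_fun R n r g) A = g A.
Proof.
by move=> /eqP cA; rewrite /value insubT mxE enum_rankK.
Qed.

(** Since [w] is total, positivity can be assumed on all sets; only its values on the fibre of [s]
    matter. *)
Definition fiber_weight {R : realType} {n : nat} (s : 'I_n.+1)
    (w : {set 'I_n.+1} -> R) (A : {set 'I_n.+1}) : R :=
  if set_sum A == s then w A else 0.

Lemma fiber_weight_ge0 (R : realType) (n : nat) (s : 'I_n.+1)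
    (w : {set 'I_n.+1} -> R) (A : {set 'I_n.+1}) :
  (forall B, 0 < w B) -> 0 <= fiber_weight s w A.
Proof. by move=> w0; rewrite /fiber_weight; case: ifP => // _; exact: ltW. Qed.

(** For fixed [e], each of the two sums equals [s] for exactly one value of [f]. A suitable [f] can
    thus be missing only if [B' :\: B] consists of precisely these two values, and comparing the
    sums of [B] and [B'] rules that out. *)
Lemma fiber_exchange (n : nat) (s : 'I_n.+1) (B B' : {set 'I_n.+1}) (e : 'I_n.+1) :
  #|B| = #|B'| -> e \in (B :\: B')%SET -> (#|(B' :\: B)%SET| != 1)%N ->
  exists2 f, f \in (B' :\: B)%SET &
    (set_sum (f |: B :\ e)%SET != s) && (set_sum (e |: B' :\ f)%SET != s).
Proof.
move=> cBB' eBB' D1.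
have cD : #|(B :\: B')%SET| = #|(B' :\: B)%SET|.
  by rewrite !cardsD setIC cBB'.
have [eB eB'] : e \in B /\ e \notin B' by move: eBB'; rewrite inE => /andP[].
(* The only candidates for which one of the exchanged sets lies in the fibre. *)
pose f1 := s - set_sum B + e; pose f2 := set_sum B' + e - s.
have good f : f \in (B' :\: B)%SET -> f != f1 -> f != f2 ->
    (set_sum (f |: B :\ e)%SET != s) && (set_sum (e |: B' :\ f)%SET != s).
  rewrite inE => /andP[fB fB'] ff1 ff2; rewrite !set_sum_exchange //.
  apply/andP; split; [apply: contra ff1 | apply: contra ff2].
    rewrite /f1 => /eqP <-.
    by rewrite -[set_sum B - e + f]addrA [set_sum B + _]addrC addrK addrC addrNK.
  rewrite /f2 => /eqP <-.
  by rewrite [set_sum B' - f + e]addrAC opprB addrCA subrr addr0.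
have [DE|] := boolP ((B' :\: B)%SET \subset [set f1; f2]%SET); last first.
  by case/fintype.subsetPn => f fD; rewrite !inE negb_or => /andP[ff1 ff2]; exists f; auto.
exfalso.
have D0 : (0 < #|(B' :\: B)%SET|)%N by rewrite -cD card_gt0; apply/set0Pn; exists e.
have D2 : (1 < #|(B' :\: B)%SET|)%N by rewrite ltn_neqAle eq_sym D1.
have f12 : f1 != f2.
  by move: (leq_trans D2 (subset_leq_card DE)); rewrite cards2; case: (f1 != f2).
have D_eq : (B' :\: B)%SET = [set f1; f2]%SET.
  by apply/eqP; rewrite eqEcard DE cards2 f12.
have D_card : #|(B :\: B')%SET| = 2%N by rewrite cD D_eq cards2 f12.
have : #|((B :\: B') :\ e)%SET| == 1%N.
  by rewrite -eqSS -D_card (cardsD1 e (B :\: B')%SET) eBB'.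
case/cards1P => b Eb.
have be : b != e by have := set11 b; rewrite -Eb !inE => /andP[].
have sB : set_sum B = set_sum (B :&: B')%SET + (e + b).
  by rewrite /set_sum [LHS](big_setID B') /= (big_setD1 e eBB') /= Eb big_set1.
have sB' : set_sum B' = set_sum (B :&: B')%SET + (f1 + f2).
  by rewrite /set_sum [LHS](big_setID B) /= D_eq setIC big_setU1 ?inE //= big_set1.
(* By definition [f1 + f2] is the sum of [B'] minus that of [B] plus [e + e], as [s] cancels.
   Inserting [sB] and [sB'] leaves [e = b], against [be]. *)
have : f1 + f2 = f1 + f2 + (- b + e).
  have f12E : f1 + f2 = set_sum B' + e - set_sum B + e by rewrite addrC addrA subrKA.
  rewrite [LHS]f12E sB sB' -[set_sum (B :&: B') + _ + e]addrA [_ + (f1 + f2 + e)]addrC.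
  by rewrite addrKA addrKA -addrA.
rewrite -[LHS]addr0 => /addrI /eqP; rewrite eq_sym addrC subr_eq0 eq_sym.
by rewrite (negPf be).
Qed.

Lemma fiber_weight_valuation (R : realType) (n r : nat) (s : 'I_n.+1)
    (w : {set 'I_n.+1} -> R) :
  (forall A, 0 < w A) -> valuation (vec_of_fun R n.+1 r (fiber_weight s w)).
Proof.
move=> w0 B B' cB cB' e eBB'.
have cD : #|(B :\: B')%SET| = #|(B' :\: B)%SET| by rewrite !cardsD setIC cB cB'.
have [eB eB'] : e \in B /\ e \notin B' by move: eBB'; rewrite inE => /andP[].
have [D1|D1] := eqVneq #|(B' :\: B)%SET| 1%N.
  have /cards1P[f Df] : #|(B' :\: B)%SET| == 1%N by rewrite D1.
  have /cards1P[e' Ee'] : #|(B :\: B')%SET| == 1%N by rewrite cD D1.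
  have Ee : (B :\: B')%SET = [set e]%SET.
    by move: eBB'; rewrite Ee' inE => /eqP ->.
  have xf x : (x == f) = (x \notin B) && (x \in B').
    by rewrite -in_setD Df inE.
  have xe x : (x == e) = (x \notin B') && (x \in B).
    by rewrite -in_setD Ee inE.
  (* When [B] and [B'] differ in one element, the exchange merely swaps them, and the inequality is
     an equality. *)
  exists f; first by rewrite Df set11.
  have -> : (f |: B :\ e)%SET = B'.
    by apply/setP => x; rewrite !inE xf xe; do 2 case: (x \in _).
  have -> : (e |: B' :\ f)%SET = B.
    by apply/setP => x; rewrite !inE xf xe; do 2 case: (x \in _).
  by rewrite addrC.
(* Otherwise both exchanged sets can be kept off the fibre, so the smaller side is 0. *)
have [f fD /andP[/negPf s1 /negPf s2]] :=
  fiber_exchange n s B B' e (etrans cB (esym cB')) eBB' D1.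
exists f => //; move: fD; rewrite inE => /andP[fB fB'].
rewrite !value_vec_of_fun ?card_exchange //.
rewrite [X in X + _ <= _]/fiber_weight s1 [X in _ + X <= _]/fiber_weight s2.
by rewrite addr0 addr_ge0 // fiber_weight_ge0.
Qed.

(** Each set on one side of the equation differs in a single element from each set on the other, so
    the fibre cannot meet both sides. If it meets one side, that side is positive and the other is
    0; hence equality holds only when all four values vanish. *)
Lemma fiber_weight_octahedron (R : realType) (n r : nat) (s : 'I_n.+1)
    (w : {set 'I_n.+1} -> R) (T : {set 'I_n.+1}) (a b c d : 'I_n.+1) :
  (forall A, 0 < w A) -> (T, (a, b), (c, d)) \in Ztriples n.+1 r ->
  ((T, (a, b), (c, d)) \in comb_type (vec_of_fun R n.+1 r (fiber_weight s w))) =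
  all (fun u => set_sum T + u != s) [:: a + c; b + d; a + d; b + c].
Proof.
move=> w0 Z; rewrite inE Z /=; move: Z; rewrite inE /= !inE !negb_or.
case/and3P => /eqP cT /and4P[/and3P[ab ac ad] /andP[bc bd] cd _].
case/and5P => aT bT cT' dT _.
rewrite !value_vec_of_fun ?cardsU2 // /fiber_weight !set_sumU2 //.
(* Cancellation in the group: sums that differ in one summand are distinct. [N1] to [N4] apply this
   to the four pairs taken across the equation. *)
have neq (u v x y : 'I_n.+1) : u != v -> x = y + u -> ~~ ((x == s) && (y + v == s)).
  move=> uv ->; apply: contra uv => /andP[/eqP <- /eqP].
  by move/addrI => ->.
have N1 : ~~ ((set_sum T + a + c == s) && (set_sum T + a + d == s)) by exact: (neq c).
have N2 : ~~ ((set_sum T + b + d == s) && (set_sum T + b + c == s)).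
  by apply: (neq d) => //; rewrite eq_sym.
have N3 : ~~ ((set_sum T + a + c == s) && (set_sum T + b + c == s)).
  by rewrite ![_ + _ + c]addrAC; exact: (neq a).
have N4 : ~~ ((set_sum T + b + d == s) && (set_sum T + a + d == s)).
  by rewrite ![_ + _ + d]addrAC; apply: (neq b) => //; rewrite eq_sym.
rewrite !addrA andbT; move: N1 N2 N3 N4.
case: (set_sum T + a + c == s); case: (set_sum T + b + d == s) => //=;
  case: (set_sum T + a + d == s); case: (set_sum T + b + c == s) => //= *;
  by [rewrite ?addr0 ?add0r ?eqxx | rewrite ?addr0 ?add0r gt_eqF ?addr_gt0
     | rewrite ?addr0 ?add0r lt_eqF ?addr_gt0].
Qed.

(** The criterion in [fiber_weight_octahedron] does not mention the weight. *)
Lemma fiber_weight_comb_class (R : realType) (n r : nat) (s : 'I_n.+1)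
    (w w' : {set 'I_n.+1} -> R) :
  (forall A, 0 < w A) -> (forall A, 0 < w' A) ->
  comb_class R r (comb_type (vec_of_fun R n.+1 r (fiber_weight s w)))
    (vec_of_fun R n.+1 r (fiber_weight s w')).
Proof.
move=> w0 w'0; split; first exact: fiber_weight_valuation.
apply/setP => -[[T [a b]] [c d]].
have [Z|Z] := boolP ((T, (a, b), (c, d)) \in Ztriples n.+1 r).
  by rewrite !fiber_weight_octahedron.
by rewrite [LHS]inE [RHS]inE (negPf Z).
Qed.

Lemma card_fiber_le_dim (R : realType) (n r : nat) (s : 'I_n.+1) :
  (#|[set A : rsubset n.+1 r | set_sum (val A) == s]%SET| <= dim_dressian R n.+1 r)%N.
Proof.
set F := [set A : rsubset n.+1 r | _]%SET.
pose one := fun _ : {set 'I_n.+1} => 1 : R.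
have one0 A : 0 < one A by exact: ltr01.
pose x0 := vec_of_fun R n.+1 r (fiber_weight s one).
(* Raising the weight of the [i]-th member of the fibre by 1 moves [x0] along the corresponding
   coordinate vector, so the differences from [x0] are distinct unit vectors. *)
pose w (i : 'I_#|F|) (A : {set 'I_n.+1}) : R := 1 + (A == val (enum_val i))%:R.
have w0 i A : 0 < w i A by rewrite ltr_pwDl.
have classP := fiber_weight_comb_class R n r s one.
apply: (@leq_trans (affine_dim (closure (comb_class R r (comb_type x0))))); last first.
  apply: (leq_bigmax_cond (comb_type x0)).
  by apply/asboolP; exists x0; exact: classP.
(* The maximum in [affine_dim] only ranges up to the number of coordinates. *)
have dP : (#|F| < #|rsubset n.+1 r|.+1)%N by rewrite ltnS max_card.
apply: (leq_bigmax_cond (Ordinal dP)).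
apply/asboolP; exists x0.
exists (\matrix_i vec_of_fun R n.+1 r (fiber_weight s (w i))); split.
- by apply: subset_closure; exact: classP.
- by move=> i; rewrite rowK; apply: subset_closure; apply: classP.
set M := (\matrix_i _ in X in row_free X).
have ME i j : M i j = (enum_val j == enum_val i)%:R.
  rewrite /M !mxE /fiber_weight /w /one (inj_eq val_inj).
  case: ifP => [_|/negbT sj]; first by rewrite addrC addKr.
  case: eqP => [ji|]; last by rewrite subrr.
  by have := enum_valP i; rewrite -ji inE (negPf sj).
(* The rows of [M] are orthonormal, so its transpose is a right inverse. *)
apply/row_freeP; exists M^T; apply/matrixP => i k; rewrite !mxE.
rewrite (bigD1 (enum_rank (enum_val i))) //= big1 ?addr0 => [|j ji].
  by rewrite [M^T _ _]mxE !ME enum_rankK eqxx mul1r (inj_eq enum_val_inj).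
rewrite ME; case: eqP => [ij|]; last by rewrite mul0r.
by rewrite -ij enum_valK eqxx in ji.
Qed.

Theorem theorem7 (R : realType) (n r : nat) (hn : (1 <= n)%N) (hr : (r <= n)%N) :
  1 / n%:R * ('C(n, r))%:R <= (dim_dressian R n r)%:R :> R.
Proof.
case: n hn hr => // n _ _.
rewrite mul1r mulrC ler_pdivrMr ?ltr0Sn // -natrM ler_nat.
have -> : 'C(n.+1, r) = #|rsubset n.+1 r|.
  by rewrite card_sig -[in LHS](card_ord n.+1) -card_draws cardsE.
(* Pigeonhole in summed form: the [n.+1] fibres partition the [r]-subsets, and each has at most
   [dim_dressian] members. *)
rewrite -sum1_card (partition_big (fun A : rsubset n.+1 r => set_sum (val A)) xpredT) //=.
rewrite mulnC -[X in (X * _)%N]card_ord -sum_nat_const; apply: leq_sum => s _.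
by rewrite sum1dep_card card_fiber_le_dim.
Qed.
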